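(* Let $\mathcal{K}\hookrightarrow\mathcal{L}$ be an inclusion of non-empty finite simplicial complexes, where $\mathcal{L}$ is an orientable pseudomanifold of dimension $q+1$ with connected dual graph. Let $c_1,\dots,c_m$ be the indicator-chain basis of $C_{q+1}^{\mathcal{L},\mathcal{K}}$, let $B_{q+1}^{\mathcal{L},\mathcal{K}}$ be the matrix of $\partial_{q+1}^{\mathcal{L},\mathcal{K}}$ in this basis, $X=(B_{q+1}^{\mathcal{L},\mathcal{K}})^TB_{q+1}^{\mathcal{L},\mathcal{K}}$, and $W=\mathrm{diag}(V_1,\dots,V_m)$ with $V_i=\langle c_i,c_i\rangle$. Let $G$ be the weighted graph associated with $X$. Then the non-zero spectrum (with multiplicities) of $\Delta_{q,\mathrm{up}}^{\mathcal{K},\mathcal{L}}$ coincides with: (i) the non-zero spectrum of the edge- and vertex-weighted graph Laplacian $L_G$ of $G$ with vertex weights $V_1,\dots,V_m$, if $\mathcal{L}$ is boundaryless; (ii) the non-zero spectrum of the edge- and vertex-weighted Laplacian with Dirichlet boundary conditions $L_G^{\mathrm{dir}}$ of $G$ with vertex weights $V_1,\dots,V_m$, otherwise.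
   Context: **Persistent up Laplacian.** $C_q^{\mathcal{X}}$ denotes real $q$-chains with the inner product making oriented $q$-simplices orthonormal. For $\mathcal{K}\subseteq\mathcal{L}$: $C_{q+1}^{\mathcal{L},\mathcal{K}}=\{c\in C_{q+1}^{\mathcal{L}}:\partial_{q+1}^{\mathcal{L}}c\in C_q^{\mathcal{K}}\}$, $\partial_{q+1}^{\mathcal{L},\mathcal{K}}:C_{q+1}^{\mathcal{L},\mathcal{K}}\to C_q^{\mathcal{K}}$ is the restriction of $\partial_{q+1}^{\mathcal{L}}$, and $\Delta_{q,\mathrm{up}}^{\mathcal{K},\mathcal{L}}=\partial_{q+1}^{\mathcal{L},\mathcal{K}}(\partial_{q+1}^{\mathcal{L},\mathcal{K}})^*$. **Pseudomanifolds.** $\mathcal{L}$ of dimension $q+1$ is an orientable pseudomanifold if every $q$-simplex is a face of at most two $(q+1)$-simplices and the $(q+1)$-simplices can be oriented so as to induce opposite orientations on shared $q$-faces; such orientations are fixed. It is boundaryless if every $q$-simplex is a face of zero or two $(q+1)$-simplices. Its dual graph has the $(q+1)$-simplices as vertices and edges between those sharing a $q$-face. **Basis.** With these orientations $C_{q+1}^{\mathcal{L},\mathcal{K}}$ has a basis $c_1,\dots,c_m$ (known to exist, unique up to order) of $0/1$ indicator chains of sets of $(q+1)$-simplices with pairwise disjoint supports. **Graph Laplacians.** For a graph with symmetric edge weights $w_{ij}\ge0$, the edge-weighted Laplacian $L^{\mathrm{edge}}$ has off-diagonal entries $-w_{ij}$ and diagonal entries $\sum_{k\ne i}w_{ik}$;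 with vertex weights $W=\mathrm{diag}(V_i)$ the edge- and vertex-weighted Laplacian is $W^{-1/2}L^{\mathrm{edge}}W^{-1/2}$. The graph $G$ associated with the symmetric matrix $X$ (off-diagonal entries $\le0$, row sums $\ge0$) has vertices $1,\dots,m$ and an edge of weight $-X_{ij}$ between $i\neq j$ whenever $X_{ij}<0$. For each $i$ whose row sum $b_i=\sum_jX_{ij}$ is positive, one adjoins an auxiliary boundary vertex joined to $i$ by an edge of weight $b_i$; the Dirichlet Laplacian is the principal submatrix of the edge-weighted Laplacian of the extended graph on the interior vertices $1,\dots,m$, and $L_G^{\mathrm{dir}}$ is obtained from it by multiplying on both sides by $W^{-1/2}$. *)

(* Defs.v *)
From HB Require Import structures.
From mathcomp Require Import all_boot all_order all_algebra.
From mathcomp Require Import boolp reals.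

Set Implicit Arguments.
Unset Strict Implicit.
Unset Printing Implicit Defensive.

Import Order.TTheory GRing.Theory Num.Theory.
Local Open Scope ring_scope.

Section Complexes.
Context {d : Order.disp_t} {T : finOrderType d}.
Implicit Types (K L X : {set {set T}}) (s t f : {set T}) (q : nat).

(* Not every point of T has to be a vertex of X. *)
Definition simplicial_complex X :=
  set0 \notin X /\
  forall s t, s \in X -> t \subset s -> t != set0 -> t \in X.

Definition simplices X q : {set {set T}} := [set s in X | #|s| == q.+1].

Definition dim X : nat := (\max_(s in X) #|s|).-1.

Definition cofaces X q f : {set {set T}} :=
  [set s in simplices X q.+1 | f \subset s].

Definition dual_adj X q : rel {set T} := fun s t =>
  [&& s \in simplices X q.+1, t \in simplices X q.+1, s != t
    & [exists f in simplices X q, (f \subset s) && (f \subset t)]].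

Definition dual_connected X q :=
  forall s t, s \in simplices X q.+1 -> t \in simplices X q.+1 ->
  connect (dual_adj X q) s t.

Definition boundaryless X q :=
  forall f, f \in simplices X q ->
  #|cofaces X q f| = 0%N \/ #|cofaces X q f| = 2%N.

End Complexes.

(* All chains, of every degree, live in one space with a basis vector for each
   subset s of T; for s nonempty it stands for the simplex s oriented by the
   order of T. The chains of X of degree q are a subspace. *)
Definition chain (R : realType) d (T : finOrderType d) := {ffun {set T} -> R^o}.

Section Chains.
Context {R : realType} {d : Order.disp_t} {T : finOrderType d}.
Implicit Types (K L X : {set {set T}}) (s t f : {set T}) (q : nat).
Local Notation C := (chain R T).
Implicit Types (x y z : C) (U W : {vspace C}).

Definition simplex s : C := [ffun t => (t == s)%:R].

Definition chains X q : {vspace C} :=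
  <<[seq simplex s | s <- enum (simplices X q)]>>%VS.

Definition ip x y : R := \sum_s x s * y s.

Definition boundary_simplex s : C :=
  \sum_(v in s) (-1) ^+ #|[set u in s | (u < v)%O]| *: simplex (s :\ v).

Definition boundary_fun x : C := \sum_s x s *: boundary_simplex s.

Fact boundary_fun_is_linear : linear boundary_fun.
Proof.
move=> a x y; rewrite /boundary_fun scaler_sumr -big_split /=.
by apply: eq_bigr => s _; rewrite !ffunE scalerDl scalerA.
Qed.

HB.instance Definition _ :=
  GRing.isLinear.Build R C C _ boundary_fun boundary_fun_is_linear.

(* On vertices this is the augmentation (with values on set0), but it is only
   applied to chains of degree at least 1. *)
Definition boundary : 'End(C) := linfun boundary_fun.

Definition rel_chains K L q : {vspace C} :=
  (chains L q.+1 :&: boundary @^-1: chains K q)%VS.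

(* vsproj does not alter anything here: see rel_boundaryE. *)
Definition rel_boundary K L q :
    'Hom(subvs_of (rel_chains K L q), subvs_of (chains K q)) :=
  (linfun (vsproj (chains K q)) \o boundary \o linfun vsval)%VF.

Lemma rel_boundaryE K L q (x : subvs_of (rel_chains K L q)) :
  vsval (rel_boundary K L q x) = boundary (vsval x).
Proof.
rewrite /rel_boundary !comp_lfunE (lfunE vsval) (lfunE (vsproj _)) /= vsprojK //.
by have := subvsP x; rewrite memv_cap => /andP[_]; rewrite -memv_preim.
Qed.

Fact ip_suml I (r : seq I) (a : I -> R) (x : I -> C) y :
  ip (\sum_(i <- r) a i *: x i) y = \sum_(i <- r) a i * ip (x i) y.
Proof.
rewrite /ip; under [RHS]eq_bigr do rewrite mulr_sumr.
rewrite exchange_big /=; apply: eq_bigr => s _.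
rewrite sum_ffunE mulr_suml; apply: eq_bigr => i _.
by rewrite !ffunE mulrA.
Qed.

Fact ipC x y : ip x y = ip y x.
Proof. by apply: eq_bigr => s _; rewrite mulrC. Qed.

Fact ip_eq0 x : ip x x = 0 -> x = 0.
Proof.
move=> /eqP; rewrite psumr_eq0 => [/allP x0|s _]; last by rewrite -expr2 sqr_ge0.
apply/ffunP => s; rewrite ffunE; apply/eqP.
by have := x0 s (mem_index_enum _); rewrite /= mulf_eq0 orbb.
Qed.

Definition is_adjoint U W (g : 'Hom(subvs_of U, subvs_of W))
    (h : 'Hom(subvs_of W, subvs_of U)) :=
  forall (x : subvs_of U) (y : subvs_of W), ip (vsval (g x)) (vsval y) = ip (vsval x) (vsval (h y)).

Lemma adjoint_exists U W (g : 'Hom(subvs_of U, subvs_of W)) :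
  exists h, is_adjoint g h.
Proof.
pose n := \dim {:subvs_of U}; pose b : n.-tuple (subvs_of U) := vbasis fullv.
have bE (u : subvs_of U) : u = \sum_i coord b i u *: tnth b i.
  rewrite [LHS](coord_vbasis (memvf u)).
  by apply: eq_bigr => i _; rewrite (tnth_nth 0).
have val_sum (a : 'I_n -> R) : vsval (\sum_i a i *: tnth b i) =
    \sum_i a i *: vsval (tnth b i).
  by rewrite linear_sum; apply: eq_bigr => i _; rewrite linearZ.
pose G := \matrix_(i, j) ip (vsval (tnth b i)) (vsval (tnth b j)) : 'M[R]_n.
have Gu : G \in unitmx.
  rewrite -row_free_unit -kermx_eq0; apply/rowV0P => v /sub_kermxP vG.
  pose u := \sum_i v 0 i *: tnth b i.
  have u0 : u = 0.
    apply: (can_inj (@vsvalK _ _ U)); rewrite linear0; apply: ip_eq0.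
    have uE : vsval u = \sum_i v 0 i *: vsval (tnth b i) by exact: val_sum.
    rewrite {1}uE ip_suml big1 // => i _; rewrite ipC uE ip_suml.
    have := congr1 (fun M : 'rV_n => M 0 i) vG; rewrite !mxE => vGi.
    by rewrite (eq_bigr (fun j => v 0 j * G j i)) ?vGi ?mulr0 // => j _;
      rewrite mxE.
  apply/rowP => i; rewrite mxE.
  have := basis_free (vbasisP {:subvs_of U}); move/freeP; apply.
  by rewrite -[RHS]u0; apply: eq_bigr => j _; rewrite (tnth_nth 0).
pose r (y : subvs_of W) := \row_j ip (vsval (g (tnth b j))) (vsval y) : 'rV[R]_n.
pose hf (y : subvs_of W) : subvs_of U := \sum_i (r y *m invmx G) 0 i *: tnth b i.
have hlin : linear hf.
  move=> a y z; rewrite /hf scaler_sumr -big_split /=; apply: eq_bigr => i _.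
  rewrite scalerA -scalerDl; congr (_ *: _).
  have -> : r (a *: y + z) = a *: r y + r z.
    apply/rowP => j; rewrite !mxE linearP /= ipC !(ipC (vsval (g _))) /ip.
    rewrite mulr_sumr -big_split /=; apply: eq_bigr => s _.
    by rewrite !ffunE mulrDl mulrA.
  by rewrite mulmxDl -scalemxAl !mxE.
pose hL := GRing.isLinear.Build R _ _ _ hf hlin.
pose h : {linear subvs_of W -> subvs_of U} := HB.pack hf hL.
exists (linfun h) => x y; rewrite lfunE /= {1 2}(bE x) linear_sum val_sum.
rewrite linear_sum /=; under [in LHS]eq_bigr do rewrite !linearZ /=.
rewrite !ip_suml; apply: eq_bigr => j _; congr (_ * _).
rewrite /hf val_sum [RHS]ipC ip_suml.
have : (r y *m invmx G *m G) 0 j = r y 0 j by rewrite mulmxKV.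
rewrite [RHS]mxE => <-; rewrite mxE; apply: eq_bigr => i _.
by congr (_ * _); rewrite mxE.
Qed.

Definition adjoint U W (g : 'Hom(subvs_of U, subvs_of W)) :
    'Hom(subvs_of W, subvs_of U) := projT1 (cid (adjoint_exists g)).

Lemma adjointP U W (g : 'Hom(subvs_of U, subvs_of W)) :
  is_adjoint g (adjoint g).
Proof. exact: projT2 (cid (adjoint_exists g)). Qed.

Definition up_laplacian K L q : 'End(subvs_of (chains K q)) :=
  (rel_boundary K L q \o adjoint (rel_boundary K L q))%VF.

(* An orientation o says, for each simplex, whether its orientation is opposite
   to the one given by the order of T. *)
Implicit Type o : {set T} -> bool.

Definition oriented_simplex o s : C := (-1) ^+ o s *: simplex s.

Definition coherent L q o :=
  forall s t f, s \in simplices L q.+1 -> t \in simplices L q.+1 -> s != t ->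
  f \in simplices L q -> f \subset s -> f \subset t ->
  boundary (oriented_simplex o s) f = - boundary (oriented_simplex o t) f.

Definition indicator_chain o (S : {set {set T}}) : C :=
  \sum_(s in S) oriented_simplex o s.

Definition indicator_basis K L q o m (c : m.-tuple C) :=
  basis_of (rel_chains K L q) c /\
  exists S : 'I_m -> {set {set T}},
    [/\ forall i, S i \subset simplices L q.+1,
        forall i j, i != j -> [disjoint S i & S j]
      & forall i, tnth c i = indicator_chain o (S i)].

(* Coordinates of the boundaries of the c_j on the simplices of K. *)
Definition boundary_mx K q m (c : m.-tuple C) : 'M[R]_(#|simplices K q|, m) :=
  \matrix_(i, j) boundary (tnth c j) (enum_val i).

Definition volumes m (c : m.-tuple C) : 'rV[R]_m :=
  \row_i ip (tnth c i) (tnth c i).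

End Chains.

Arguments coherent R {d T} L q o.

Definition orientable_pseudomanifold (R : realType) d (T : finOrderType d)
    (L : {set {set T}}) (q : nat) :=
  [/\ dim L = q.+1,
      forall f, f \in simplices L q -> (#|cofaces L q f| <= 2)%N
    & exists o, coherent R L q o].

Section GraphLaplacians.
Context {R : realType}.

Definition laplacian (I : finType) (w : I -> I -> R) (x y : I) : R :=
  if x == y then \sum_(z | z != x) w x z else - w x y.

Context {m : nat}.
Implicit Types (X : 'M[R]_m) (V : 'rV[R]_m).

Definition edge_weight X (i j : 'I_m) : R :=
  if (i != j) && (X i j < 0) then - X i j else 0.

Definition row_sum X (i : 'I_m) : R := \sum_j X i j.

Definition edge_laplacian X : 'M[R]_m :=
  \matrix_(i, j) laplacian (edge_weight X) i j.

Definition boundary_vertex X := {i : 'I_m | 0 < row_sum X i}.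

Definition ext_weight X (x y : 'I_m + boundary_vertex X) : R :=
  match x, y with
  | inl i, inl j => edge_weight X i j
  | inl i, inr k | inr k, inl i => if val k == i then row_sum X i else 0
  | inr _, inr _ => 0
  end.

Definition edge_laplacian_dir X : 'M[R]_m :=
  \matrix_(i, j) laplacian (@ext_weight X) (inl i) (inl j).

Definition vertex_weighted V (A : 'M[R]_m) : 'M[R]_m :=
  let D := diag_mx (\row_i (Num.sqrt (V 0 i))^-1) in D *m A *m D.

End GraphLaplacians.

(* Multiplicities are dimensions of eigenspaces. All operators considered are
   self-adjoint over R, so these agree with the algebraic multiplicities and
   there are no non-real eigenvalues. *)
Definition same_nonzero_spectrum (R : realType) (E : vectType R) (g : 'End(E))
    (m : nat) (A : 'M[R]_m) :=
  forall a : R, a != 0 ->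
  \dim (passmx.leigenspace g a) = \rank (eigenspace A a).

(* Main.v *)
(* Write D for the boundary map of the pair. The nonzero spectra of D D* and
   D* D agree, and the matrix of D* D in the orthonormal basis c_i / sqrt V_i is
   W^(-1/2) X W^(-1/2). It remains to see that X is the (Dirichlet) Laplacian of
   its own graph. Coherence makes the off-diagonal entries X i j = <D c_i, D c_j>
   nonpositive, and the row sums <D c_i, D (sum_j c_j)> are nonnegative because a
   q-simplex has at most two cofaces. If L has no boundary, then sum_j c_j is the
   fundamental cycle and the row sums vanish. *)

Require Import Defs.
From HB Require Import structures.
From mathcomp Require Import all_boot all_order all_algebra.
From mathcomp Require Import reals.

Set Implicit Arguments.
Unset Strict Implicit.
Unset Printing Implicit Defensive.

Import Order.TTheory GRing.Theory Num.Theory.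
Local Open Scope ring_scope.

(** * Nonzero eigenspaces of compositions, and eigenspaces of matrices acting on row vectors *)

Section Spectrum.
Context {F : fieldType}.

Lemma mem_leigenspace {E : vectType F} (g : 'End(E)) a x :
  (x \in passmx.leigenspace g a) = (g x == a *: x).
Proof.
by rewrite memv_ker add_lfunE opp_lfunE scale_lfunE id_lfunE subr_eq0.
Qed.

(** [p] maps the eigenspace of [s \o p] into that of [p \o s], and injectively: [p x = 0] forces
    [a *: x = 0], hence [x = 0] because [a] is nonzero. *)
Lemma dim_leigenspace_comp_le {E E' : vectType F}
    (p : 'Hom(E, E')) (s : 'Hom(E', E)) a : a != 0 ->
  (\dim (passmx.leigenspace (s \o p) a) <= \dim (passmx.leigenspace (p \o s) a))%N.
Proof.
move=> a0; rewrite -(@limg_dim_eq _ _ _ p).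
  apply/dimvS/subvP => _ /memv_imgP[x + ->].
  by rewrite !mem_leigenspace !comp_lfunE /= => /eqP ->; rewrite linearZ.
apply/eqP; rewrite -subv0; apply/subvP => x; rewrite memv_cap memv_ker memv0.
rewrite mem_leigenspace comp_lfunE => /andP[/eqP spx /eqP px0].
by move: spx; rewrite px0 linear0 => /esym/eqP; rewrite scaler_eq0 (negPf a0).
Qed.

Lemma dim_leigenspace_comp {E E' : vectType F}
    (p : 'Hom(E, E')) (s : 'Hom(E', E)) a : a != 0 ->
  \dim (passmx.leigenspace (s \o p) a) = \dim (passmx.leigenspace (p \o s) a).
Proof. by move=> a0; apply/anti_leq; rewrite !dim_leigenspace_comp_le. Qed.

(** The rows of a row base of [kermx M] form a basis of [lker f]. This links dimensions of subspaces
    to ranks of matrices. *)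
Lemma dim_lker_mulmxr {n m : nat} (f : 'Hom('rV[F]_n, 'rV[F]_m)) (M : 'M_(n, m)) :
  (forall v, f v = v *m M) -> \dim (lker f) = \rank (kermx M).
Proof.
move=> fE; pose b := [tuple row i (row_base (kermx M)) | i < \rank (kermx M)].
have bsum (k : 'I__ -> F) :
    \sum_i k i *: b`_i = (\row_i k i) *m row_base (kermx M).
  rewrite mulmx_sum_row; apply: eq_bigr => i _.
  by rewrite -tnth_nth tnth_mktuple mxE.
suff /size_basis : basis_of (lker f) b by [].
rewrite /basis_of eqEsubv; apply/andP; split; last first.
  apply/freeP => k; rewrite bsum -[X in _ = X -> _](mul0mx _ (row_base (kermx M))).
  move/(row_free_inj (row_base_free _)) => k0 i.
  by have := congr1 (fun v : 'rV_ _ => v 0 i) k0; rewrite !mxE.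
apply/andP; split.
  apply/span_subvP => _ /mapP[i _ ->]; rewrite memv_ker fE; apply/eqP.
  apply/sub_kermxP; apply: submx_trans (row_sub _ _) _.
  by rewrite eq_row_base.
apply/subvP => v; rewrite memv_ker fE => /eqP/sub_kermxP.
rewrite -(eq_row_base (kermx M)) => /submxP[k ->].
rewrite mulmx_sum_row; apply: memv_suml => i _; apply/memvZ/memv_span.
by apply/mapP; exists i; rewrite ?mem_enum.
Qed.

Lemma dim_leigenspace_mulmxr {n : nat} (g : 'End('rV[F]_n)) (A : 'M_n) a :
  (forall v, g v = v *m A) ->
  \dim (passmx.leigenspace g a) = \rank (eigenspace A a).
Proof.
move=> gE; apply: dim_lker_mulmxr => v.
by rewrite add_lfunE opp_lfunE scale_lfunE id_lfunE gE mulmxBr mul_mx_scalar.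
Qed.

End Spectrum.

(** * Orthogonal bases and the Gram matrix of a linear map *)

Section InnerProduct.
Context {R : realType} {d : Order.disp_t} {T : finOrderType d}.
Local Notation C := (chain R T).
Implicit Types (x y z : C) (U W : {vspace C}).

Lemma ip_sumr I (r : seq I) (a : I -> R) (x : I -> C) y :
  ip y (\sum_(i <- r) a i *: x i) = \sum_(i <- r) a i * ip y (x i).
Proof. by rewrite ipC ip_suml; under eq_bigr do rewrite ipC. Qed.

Lemma ipDr x y z : ip x (y + z) = ip x y + ip x z.
Proof. by rewrite -big_split; apply: eq_bigr => s _; rewrite ffunE mulrDr. Qed.

Lemma ipZr a x y : ip x (a *: y) = a * ip x y.
Proof. by rewrite mulr_sumr; apply: eq_bigr => s _; rewrite ffunE mulrCA. Qed.

Lemma ipZl a x y : ip (a *: x) y = a * ip x y.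
Proof. by rewrite ipC ipZr ipC. Qed.

Lemma ip_ge0 x : 0 <= ip x x.
Proof. by apply: sumr_ge0 => s _; rewrite -expr2 sqr_ge0. Qed.

Lemma orthogonal_expansion U m (c : m.-tuple C) x :
  basis_of U c -> (forall i j, i != j -> ip (tnth c i) (tnth c j) = 0) ->
  x \in U ->
  x = \sum_i (ip (tnth c i) x / ip (tnth c i) (tnth c i)) *: tnth c i.
Proof.
move=> cU c_orth xU; have xE := coord_basis cU xU.
rewrite {1}xE; apply: eq_bigr => i _; rewrite -tnth_nth; congr (_ *: _).
rewrite {2}xE ip_sumr (bigD1 i) //= big1 => [|j ji]; last first.
  by rewrite -tnth_nth c_orth ?mulr0 // eq_sym.
rewrite -tnth_nth addr0 mulfK //; apply/eqP => /ip_eq0 ci0.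
by have /free_not0 := basis_free cU; move/(_ 0); rewrite -{1}ci0 mem_tnth eqxx => /(_ isT).
Qed.

(** Swapping factors replaces [g \o adjoint g] by [adjoint g \o g]. In the orthonormal basis
    obtained by normalising [c], the latter has as its matrix the Gram matrix [X] scaled on both
    sides. *)
Lemma spectrum_gram U W (g : 'Hom(subvs_of U, subvs_of W)) m (c : m.-tuple C)
    (X : 'M[R]_m) :
  basis_of U c -> (forall i j, i != j -> ip (tnth c i) (tnth c j) = 0) ->
  (forall i j, X i j = ip (vsval (g (vsproj U (tnth c i))))
                          (vsval (g (vsproj U (tnth c j))))) ->
  same_nonzero_spectrum (g \o adjoint g)%VF (vertex_weighted (volumes c) X).
Proof.
move=> cU c_orth XE a a0.
have cUi i : tnth c i \in U by rewrite (basis_mem cU) ?mem_tnth.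
pose D i := (Num.sqrt (volumes c 0 i))^-1.
have DE i : (ip (tnth c i) (tnth c i))^-1 = D i * D i.
  by rewrite -invfM -expr2 mxE sqr_sqrtr ?ip_ge0.
(* [e] is the orthonormal basis; [t] below builds a vector from its coordinates in [e], and [p]
   reads these coordinates off. *)
have [e eE] : exists e : 'I_m -> subvs_of U, forall i, e i = D i *: vsproj U (tnth c i).
  by exists (fun i => D i *: vsproj U (tnth c i)).
pose tf (v : 'rV[R]_m) := \sum_i v 0 i *: e i.
have t_lin : linear tf.
  move=> k u v; rewrite /tf scaler_sumr -big_split /=; apply: eq_bigr => i _.
  by rewrite !mxE scalerDl scalerA.
pose t : {linear 'rV[R]_m -> subvs_of U} :=
  HB.pack tf (GRing.isLinear.Build R _ _ _ tf t_lin).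
pose pf (u : subvs_of U) := \row_i ip (vsval (e i)) (vsval u) : 'rV[R]_m.
have p_lin : linear pf.
  move=> k u v; apply/rowP => i.
  by rewrite !mxE linearP ipDr ipZr.
pose p : {linear subvs_of U -> 'rV[R]_m} :=
  HB.pack pf (GRing.isLinear.Build R _ _ _ pf p_lin).
have tpK : (linfun t \o linfun p = \1)%VF.
  apply/lfunP => u; rewrite comp_lfunE !lfunE /=.
  apply: (can_inj (@vsvalK _ _ U)).
  rewrite [RHS](orthogonal_expansion cU c_orth (subvsP _)).
  rewrite /tf linear_sum; apply: eq_bigr => i _; rewrite linearZ /= mxE eE.
  by rewrite linearZ /= vsprojK // scalerA ipZl DE mulrA (mulrC (ip _ _)).
rewrite dim_leigenspace_comp //.
(* Inserting [t \o p = 1] on the left and moving [t] to the right end leaves an endomorphism of row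
   vectors, [p \o adjoint g \o g \o t]. *)
rewrite -[adjoint g]comp_lfun1l -tpK -!comp_lfunA dim_leigenspace_comp //.
have AE i j : vertex_weighted (volumes c) X i j = D i * X i j * D j.
  by rewrite /vertex_weighted /D mul_mx_diag mxE mul_diag_mx !mxE.
apply: dim_leigenspace_mulmxr => v; apply/rowP => i.
rewrite !comp_lfunE !lfunE /= [LHS]mxE [RHS]mxE -adjointP.
have -> : vsval (g (tf v)) = \sum_j v 0 j *: vsval (g (e j)).
  by rewrite !linear_sum; apply: eq_bigr => j _; rewrite !linearZ.
rewrite ip_sumr; apply: eq_bigr => j _; congr (_ * _).
rewrite AE XE !eE !linearZ /= ipZl ipZr.
by rewrite mulrCA mulrA ipC mulrAC.
Qed.

End InnerProduct.

(** * Matrices that are the Laplacian of their own graph *)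

Section GraphLaplacians.
Context {R : realType} {m : nat}.
Implicit Types (X : 'M[R]_m) (i j : 'I_m).

Lemma edge_weightE X i j : i != j -> X i j <= 0 -> edge_weight X i j = - X i j.
Proof.
rewrite /edge_weight => -> /=; rewrite le_eqVlt => /orP[/eqP -> | ->] //.
by rewrite ltxx oppr0.
Qed.

Lemma sum_edge_weight X i :
  (forall j, i != j -> X i j <= 0) ->
  \sum_(j | j != i) edge_weight X i j = X i i - row_sum X i.
Proof.
move=> Xle0; rewrite /row_sum [in RHS](bigD1 i) //= opprD addrA subrr add0r -sumrN.
by apply: eq_bigr => j ji; rewrite edge_weightE ?Xle0 // eq_sym.
Qed.

Lemma edge_laplacian_id X :
  (forall i j, i != j -> X i j <= 0) -> (forall i, row_sum X i = 0) ->
  edge_laplacian X = X.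
Proof.
move=> Xle0 X0; apply/matrixP => i j; rewrite mxE /laplacian.
have [<-|ij] := eqVneq i j; last by rewrite edge_weightE ?Xle0 ?opprK.
by rewrite sum_edge_weight ?X0 ?subr0 // => k; apply: Xle0.
Qed.

(** The interior edges at [i] have total weight [X i i - row_sum X i]; the edge to the boundary
    vertex supplies the missing row sum. *)
Lemma edge_laplacian_dir_id X :
  (forall i j, i != j -> X i j <= 0) -> (forall i, 0 <= row_sum X i) ->
  edge_laplacian_dir X = X.
Proof.
move=> Xle0 Xge0; apply/matrixP => i j; rewrite mxE /laplacian.
have inlE k l : (inl k == inl l :> 'I_m + boundary_vertex X) = (k == l) by [].
rewrite inlE; have [<-|ij] := eqVneq i j; last first.
  by rewrite /= edge_weightE ?Xle0 ?opprK.
rewrite big_sumType /= (eq_bigl (fun k => k != i)) //.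
rewrite sum_edge_weight => [|k]; last exact: Xle0.
suff -> : \sum_(k : boundary_vertex X) (if val k == i then row_sum X i else 0)
    = row_sum X i by rewrite subrK.
(* If the row sum is positive, [Sub i Xi] is the only boundary vertex joined to [i]; otherwise the
   row sum is 0 and so is every term. *)
have [Xi|] := boolP (0 < row_sum X i).
  rewrite (bigD1 (Sub i Xi)) //= eqxx big1 ?addr0 // => k.
  by rewrite -val_eqE /= => /negPf ->.
rewrite lt_neqAle Xge0 andbT negbK => /eqP <-.
by apply: big1 => k _; rewrite if_same.
Qed.

End GraphLaplacians.

(** * Boundaries of oriented simplices and of indicator chains *)

Section Boundary.
Context {R : realType} {d : Order.disp_t} {T : finOrderType d}.
Local Notation C := (chain R T).
Implicit Types (K L X S : {set {set T}}) (s t f : {set T}) (q : nat).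
Implicit Types (x y : C) (o : {set T} -> bool).

Lemma chain_sum x : x = \sum_s x s *: simplex s.
Proof.
apply/ffunP => t; rewrite sum_ffunE (bigD1 t) //= big1 => [|s st].
  by rewrite !ffunE eqxx addr0 [RHS]mulr1.
by rewrite !ffunE eq_sym (negPf st) [LHS]mulr0.
Qed.

Lemma memv_chains X q x :
  x \in chains X q <-> forall s, s \notin simplices X q -> x s = 0.
Proof.
split=> [xX s sX | x0].
  rewrite (coord_span (X := in_tuple _) xX) sum_ffunE big1 // => i _.
  have lti : (i < size (enum (simplices X q)))%N by case: i => i /=; rewrite size_map.
  rewrite ffunE /= (nth_map s) // ffunE; case: eqP => [sE|_]; last exact: mulr0.
  by move: sX; rewrite sE -mem_enum mem_nth.
rewrite [x]chain_sum; apply: memv_suml => s _.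
have [sX|/x0 ->] := boolP (s \in simplices X q); last by rewrite scale0r mem0v.
by apply/memvZ/memv_span/map_f; rewrite mem_enum.
Qed.

Lemma boundary_simplex_face s f :
  boundary_simplex s f != 0 :> R -> exists2 v, v \in s & f = s :\ v.
Proof.
move=> sf; have [/exists_inP[v vs /eqP]|/exists_inPn nface] :=
  boolP [exists v in s, f == s :\ v]; first by exists v.
case/eqP: sf; rewrite sum_ffunE big1 // => v /nface /negPf fv.
by rewrite !ffunE fv [LHS]mulr0.
Qed.

Lemma oriented_simplexE o s t :
  oriented_simplex o s t = if t == s then (-1) ^+ o s else 0 :> R.
Proof. by rewrite !ffunE; case: eqP => _; [exact: mulr1 | exact: mulr0]. Qed.

Lemma boundary_oriented_simplexE o s f :
  boundary (oriented_simplex o s) f = (-1) ^+ o s * boundary_simplex s f :> R.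
Proof.
rewrite lfunE /= /boundary_fun sum_ffunE (bigD1 s) //= big1 => [|t ts].
  by rewrite ffunE oriented_simplexE eqxx addr0.
by rewrite ffunE oriented_simplexE (negPf ts) [LHS]mul0r.
Qed.

Lemma boundary_oriented_simplex_face L q o s f :
  simplicial_complex L -> s \in simplices L q.+1 ->
  boundary (oriented_simplex o s) f != 0 :> R ->
  f \in simplices L q /\ f \subset s.
Proof.
move=> [_ Lsub]; rewrite inE => /andP[sL /eqP s_card].
rewrite boundary_oriented_simplexE mulf_eq0 negb_or => /andP[_].
case/boundary_simplex_face => v vs ->; split; last exact: subsetDl.
have card_sv : #|s :\ v| = q.+1 by move: s_card; rewrite (cardsD1 v) vs => -[].
rewrite inE card_sv eqxx andbT (Lsub s) ?subsetDl //.
(* The closure property of a complex requires a nonempty face; this one has [q.+1] vertices. *)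
by rewrite -card_gt0 card_sv.
Qed.

Lemma boundary_indicator_chain o S f :
  boundary (indicator_chain o S) f =
    \sum_(s in S) boundary (oriented_simplex o s) f :> R.
Proof. by rewrite linear_sum sum_ffunE. Qed.

Lemma indicator_chainE o S s :
  indicator_chain o S s = if s \in S then (-1) ^+ o s else 0 :> R.
Proof.
rewrite sum_ffunE; case: ifP => sS.
  rewrite (bigD1 s) //= big1 => [|t /andP[_ ts]].
    by rewrite oriented_simplexE eqxx addr0.
  by rewrite oriented_simplexE eq_sym (negPf ts).
apply: big1 => t tS; rewrite oriented_simplexE; case: eqP => // st.
by rewrite -st sS in tS.
Qed.

Lemma indicator_chain_orthogonal o S S' :
  [disjoint S & S'] -> ip (indicator_chain o S) (indicator_chain o S') = 0 :> R.
Proof.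
move=> SS'; apply: big1 => s _; rewrite !indicator_chainE.
case: ifP => sS; last exact: mul0r.
by rewrite (disjointFr SS' sS) mulr0.
Qed.

Lemma indicator_chain_neq0 o S : indicator_chain o S != 0 :> C -> S != set0.
Proof. by apply: contraNneq => ->; rewrite /indicator_chain big_set0. Qed.

(** * Signs and cancellations under a coherent orientation *)

Section Coherent.
Context {L : {set {set T}}} {q : nat} {o : {set T} -> bool}.
Hypotheses (L_complex : simplicial_complex L) (o_coherent : coherent R L q o).

(** If neither factor vanishes, [f] is a [q]-simplex of [L] shared by [s] and [t], and coherence
    makes the product minus a square. *)
Lemma coherent_mul_le0 s t f :
  s \in simplices L q.+1 -> t \in simplices L q.+1 -> s != t ->
  boundary (oriented_simplex o s) f * boundary (oriented_simplex o t) f <= 0 :> R.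
Proof.
move=> sL tL st.
have [->|sf] := eqVneq (boundary (oriented_simplex o s) f : R) 0.
  by rewrite mul0r.
have [->|tf] := eqVneq (boundary (oriented_simplex o t) f : R) 0.
  by rewrite mulr0.
have [fL fs] := boundary_oriented_simplex_face L_complex sL sf.
have [_ ft] := boundary_oriented_simplex_face L_complex tL tf.
by rewrite (o_coherent sL tL st fL fs ft) mulNr oppr_le0 -expr2 sqr_ge0.
Qed.

(** The inner product expands over pairs of simplices from [S] and [S'], which are distinct by
    disjointness, so each term is nonpositive. *)
Lemma ip_boundary_disjoint_le0 S S' :
  S \subset simplices L q.+1 -> S' \subset simplices L q.+1 ->
  [disjoint S & S'] ->
  ip (boundary (indicator_chain o S)) (boundary (indicator_chain o S')) <= 0 :> R.
Proof.
move=> /subsetP SL /subsetP SL' SS'; apply: sumr_le0 => f _.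
rewrite !boundary_indicator_chain mulr_suml; apply: sumr_le0 => s sS.
rewrite mulr_sumr; apply: sumr_le0 => t tS'.
apply: coherent_mul_le0; [exact: SL | exact: SL' |].
by apply: contraTneq tS' => <-; rewrite (disjointFr SS' sS).
Qed.

(* At most one simplex of [S] other than [s] has [f] as a face, and it can only
   cancel the contribution of [s]. *)
Lemma ip_boundary_sub_ge0 S S' :
  (forall f, f \in simplices L q -> (#|cofaces L q f| <= 2)%N) ->
  S' \subset S -> S \subset simplices L q.+1 ->
  0 <= ip (boundary (indicator_chain o S')) (boundary (indicator_chain o S)) :> R.
Proof.
move=> cof2 /subsetP S'S /subsetP SL; apply: sumr_ge0 => f _.
rewrite !boundary_indicator_chain mulr_suml; apply: sumr_ge0 => s /S'S sS.
have [->|sf] := eqVneq (boundary (oriented_simplex o s) f : R) 0.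
  by rewrite mul0r.
have [fL fs] := boundary_oriented_simplex_face L_complex (SL s sS) sf.
have coface t : t \in S -> boundary (oriented_simplex o t) f != 0 :> R ->
    t \in cofaces L q f.
  move=> tS /(boundary_oriented_simplex_face L_complex (SL t tS))[_ ft].
  by rewrite inE SL.
rewrite (bigD1 s) //=.
have [/exists_inP[t /andP[tS ts] tf]|/exists_inPn none] := boolP
  [exists t in [pred t | (t \in S) && (t != s)],
     boundary (oriented_simplex o t) f != 0 :> R].
  have [_ ft] := boundary_oriented_simplex_face L_complex (SL t tS) tf.
  rewrite (bigD1 t) /=; last by rewrite tS.
  rewrite (o_coherent (SL t tS) (SL s sS) ts fL ft fs) addNKr.
  rewrite big1 ?mulr0 // => u /andP[/andP[uS us] ut]; apply/eqP.
  apply: contraTT (cof2 f fL) => uf; rewrite -ltnNge.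
  apply: leq_trans (subset_leq_card (_ : [set s; t; u] \subset _)).
    by rewrite setUC !cardsU1 !inE cards1 negb_or us ut (eq_sym s) ts.
  apply/subsetP => w; rewrite in_setU in_set2 in_set1.
  by move=> /orP[/orP[]|] /eqP ->; apply: coface.
by rewrite big1 ?addr0 -?expr2 ?sqr_ge0 // => t /none; rewrite negbK => /eqP.
Qed.

(** Only cofaces of [f] contribute to the coefficient at [f]; there are none or two, and two
    contributions cancel by coherence. *)
Lemma boundary_fundamental_chain :
  boundaryless L q -> boundary (indicator_chain o (simplices L q.+1)) = 0 :> C.
Proof.
move=> bL; apply/ffunP => f; rewrite boundary_indicator_chain ffunE.
rewrite (bigID [in cofaces L q f]) /= [X in _ + X]big1 ?addr0 => [|s]; last first.
  case/andP => sL; apply: contraNeq => sf.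
  by have [_ fs] := boundary_oriented_simplex_face L_complex sL sf; rewrite inE sL.
rewrite (eq_bigl (fun s => s \in cofaces L q f)) => [|s]; last first.
  by rewrite !inE andbA andbb.
have [fL|fL] := boolP (f \in simplices L q); last first.
  apply: big1 => s /setIdP[sL _]; apply/eqP; apply: contraNT fL => sf.
  by have [] := boundary_oriented_simplex_face L_complex sL sf.
have [cof0 | /eqP/cards2P[s [t [st cofE]]]] := bL f fL.
  by rewrite (cards0_eq cof0) big_set0.
have /setIdP[sL fs] : s \in cofaces L q f by rewrite cofE !inE eqxx.
have /setIdP[tL ft] : t \in cofaces L q f by rewrite cofE !inE eqxx orbT.
rewrite cofE big_setU1 ?inE //= big_set1.
by rewrite (o_coherent sL tL st fL fs ft) addNr.
Qed.

End Coherent.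
End Boundary.

(** * The Gram matrix of the boundaries of the indicator basis *)

Section IndicatorBasis.
Context {R : realType} {d : Order.disp_t} {T : finOrderType d}.
Context {K L : {set {set T}}} {q m : nat} {o : {set T} -> bool}.
Context {c : m.-tuple (chain R T)} {S : 'I_m -> {set {set T}}}.
Hypotheses (L_complex : simplicial_complex L) (o_coherent : coherent R L q o).
Hypothesis c_basis : basis_of (rel_chains K L q) c.
Hypothesis S_sub : forall i, S i \subset simplices L q.+1.
Hypothesis S_disjoint : forall i j, i != j -> [disjoint S i & S j].
Hypothesis cE : forall i, tnth c i = indicator_chain o (S i).

Lemma rel_chains_basis i : tnth c i \in rel_chains K L q.
Proof. by rewrite (basis_mem c_basis) ?mem_tnth. Qed.

(** Restricting coordinates to [K] loses nothing: the boundary of a relative chain vanishes off the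
    [q]-simplices of [K]. *)
Lemma gram_boundary_mx i j :
  ((boundary_mx K q c)^T *m boundary_mx K q c) i j =
    ip (boundary (tnth c i)) (boundary (tnth c j)).
Proof.
rewrite mxE [RHS](bigID [in simplices K q]) /= [X in _ + X]big1 ?addr0 => [|f fK].
  by rewrite [RHS]big_enum_val; apply: eq_bigr => k _; rewrite !mxE.
suff -> : boundary (tnth c i) f = 0 by rewrite mul0r.
have := rel_chains_basis i; rewrite memv_cap -memv_preim => /andP[_].
by move/memv_chains; apply.
Qed.

Lemma indicator_basis_orthogonal i j :
  i != j -> ip (tnth c i) (tnth c j) = 0.
Proof. by move=> ij; rewrite !cE indicator_chain_orthogonal ?S_disjoint. Qed.

Lemma up_laplacian_spectrum :
  same_nonzero_spectrum (up_laplacian K L q)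
    (vertex_weighted (volumes c) ((boundary_mx K q c)^T *m boundary_mx K q c)).
Proof.
apply: (spectrum_gram c_basis indicator_basis_orthogonal) => i j.
by rewrite !rel_boundaryE !vsprojK ?rel_chains_basis // gram_boundary_mx.
Qed.

Lemma gram_offdiag_le0 i j : i != j ->
  ((boundary_mx K q c)^T *m boundary_mx K q c) i j <= 0.
Proof.
move=> ij; rewrite gram_boundary_mx !cE.
by apply: (ip_boundary_disjoint_le0 L_complex o_coherent); rewrite ?S_disjoint.
Qed.

Lemma sum_indicator_basis :
  \sum_j tnth c j = indicator_chain o (\bigcup_j S j).
Proof.
rewrite /indicator_chain partition_disjoint_bigcup //.
by apply: eq_bigr => j _; rewrite cE.
Qed.

Lemma gram_row_sum i :
  row_sum ((boundary_mx K q c)^T *m boundary_mx K q c) i =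
    ip (boundary (tnth c i)) (boundary (\sum_j tnth c j)).
Proof.
have -> : boundary (\sum_j tnth c j) = \sum_j 1 *: boundary (tnth c j).
  by rewrite linear_sum; apply: eq_bigr => j _; rewrite scale1r.
by rewrite ip_sumr; apply: eq_bigr => j _; rewrite mul1r gram_boundary_mx.
Qed.

(** By disjointness of supports the sum of the basis is again an indicator chain, whose support
    contains [S i], so [ip_boundary_sub_ge0] applies. *)
Lemma gram_row_sum_ge0 i :
  (forall f, f \in simplices L q -> (#|cofaces L q f| <= 2)%N) ->
  0 <= row_sum ((boundary_mx K q c)^T *m boundary_mx K q c) i.
Proof.
move=> cof2; rewrite gram_row_sum sum_indicator_basis cE.
apply: (ip_boundary_sub_ge0 L_complex o_coherent cof2).
  exact: bigcup_sup.
by apply/bigcupsP => j _.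
Qed.

(* The fundamental chain is a cycle, hence a combination of the [c_j]; all its
   coefficients are [1] because it has value [1] on every oriented simplex. *)
Lemma boundaryless_sum_indicator_basis :
  boundaryless L q -> \sum_j tnth c j = indicator_chain o (simplices L q.+1).
Proof.
move=> bL; have [z zE] : exists z, z = indicator_chain o (simplices L q.+1) :> chain R T.
  by exists (indicator_chain o (simplices L q.+1)).
rewrite -zE.
have zU : z \in rel_chains K L q.
  rewrite zE memv_cap -memv_preim boundary_fundamental_chain // mem0v andbT.
  by apply/memv_chains => s sL; rewrite indicator_chainE (negPf sL).
rewrite [RHS](coord_basis c_basis zU); apply: eq_bigr => j _; rewrite -tnth_nth.
(* Basis vectors are nonzero, so there is a simplex [s] in [S j]; all other basis chains vanish at
   [s], which isolates the coefficient of [c_j]. *)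
have : S j != set0.
  apply: (@indicator_chain_neq0 R _ _ o); rewrite -cE.
  exact: free_not0 (basis_free c_basis) (mem_tnth j c).
case/set0Pn => s sj.
have := congr1 (fun x : chain R T => x s) (coord_basis c_basis zU).
rewrite /= sum_ffunE (bigD1 j) //= big1 => [|k kj]; last first.
  rewrite -tnth_nth ffunE cE indicator_chainE.
  by rewrite (disjointFl (S_disjoint kj) sj) [LHS]mulr0.
rewrite -tnth_nth addr0 ffunE zE cE !indicator_chainE sj (subsetP (S_sub j)) //.
rewrite -[X in X = _ -> _]mul1r => /mulIf <-; first by rewrite scale1r.
by rewrite signr_eq0.
Qed.

Lemma boundaryless_gram_row_sum i :
  boundaryless L q ->
  row_sum ((boundary_mx K q c)^T *m boundary_mx K q c) i = 0.
Proof.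
move=> bL; rewrite gram_row_sum boundaryless_sum_indicator_basis //.
rewrite boundary_fundamental_chain //; apply: big1 => s _.
by rewrite ffunE mulr0.
Qed.

End IndicatorBasis.

Theorem theorem6p1 (R : realType) (d : Order.disp_t) (T : finOrderType d)
    (K L : {set {set T}}) (q : nat) (o : {set T} -> bool)
    (m : nat) (c : m.-tuple (chain R T)) :
  simplicial_complex K -> simplicial_complex L ->
  K != set0 -> L != set0 -> K \subset L ->
  orientable_pseudomanifold R L q -> dual_connected L q ->
  coherent R L q o -> indicator_basis K L q o c ->
  let B := boundary_mx K q c in
  let X := B^T *m B in
  let V := volumes c in
  (boundaryless L q ->
     same_nonzero_spectrum (up_laplacian K L q)
       (vertex_weighted V (edge_laplacian X))) /\
  (~ boundaryless L q ->
     same_nonzero_spectrum (up_laplacian K L q)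
       (vertex_weighted V (edge_laplacian_dir X))).
Proof.
move=> _ L_complex _ _ _ [_ cof2 _] _ o_coherent [c_basis [S [S_sub S_disj cE]]] B X V.
have spec := up_laplacian_spectrum c_basis S_disj cE.
have Xle0 := gram_offdiag_le0 L_complex o_coherent c_basis S_sub S_disj cE.
(* In both cases the graph Laplacian equals [X], so [spec] concludes once the row sums are known to
   be zero, respectively nonnegative. *)
split=> [bL | _].
  rewrite edge_laplacian_id //.
  by move=> i; apply: (boundaryless_gram_row_sum L_complex o_coherent c_basis S_sub S_disj cE).
rewrite edge_laplacian_dir_id //.
by move=> i; apply: (gram_row_sum_ge0 L_complex o_coherent c_basis S_sub S_disj cE).
Qed.
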